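(* Let $G$ be a group with an invariant partial order $\leq$, and let $f: G \to \mathbb{R}$ be a non-zero homogeneous quasimorphism. If $f$ sandwiches $\leq$, then $\leq$ is admissible and for all $g \in G^{++}$ and $h \in G$ the relative growth is $$\gamma(g,h) = \frac{f(h)}{f(g)}.$$
   Context: A homogeneous quasimorphism on a group $G$ is a map $f: G \to \mathbb{R}$ with $f(g^n) = n f(g)$ for all $g \in G$, $n \in \mathbb{Z}$, such that $(g,h) \mapsto f(gh) - f(g) - f(h)$ is bounded on $G \times G$. A partial order $\leq$ on $G$ is invariant if $g \leq h$ implies $kg \leq kh$ and $gk \leq hk$ for all $g,h,k\in G$. Its order semigroup is $G^+ := \{g \in G \mid g \geq e\}$, and its set of dominants is $G^{++} := \{g \in G^+ \setminus\{e\} \mid \forall h \in G\ \exists n \in \mathbb{N}: g^n \geq h\}$. The order is admissible if $G^{++} \neq \emptyset$. For $g \in G^{++}$, $h \in G$ the relative growth is $\gamma(g,h) := \lim_{n \to \infty} \frac{1}{n}\min\{p \in \mathbb{Z} \mid g^p \geq h^n\}$. For $C \in \mathbb{R}$ let $Q_f^+(C) := \{g \in G \mid f(g) \geq C\}$. A non-zero homogeneous quasimorphism $f$ sandwiches $\leq$ if there exist constants $C_1, C_2 \in \mathbb{R}$ such that $Q_f^+(C_1) \subset G^+ \subset Q_f^+(C_2)$. (Any abstract group may be regarded as a discrete topological group, so no continuity requirement on $f$ is needed.) *)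

(* Defs.v *)
From HB Require Import structures.
From mathcomp Require Import all_boot all_order all_algebra.
From mathcomp Require Import all_classical all_reals all_analysis.

Set Implicit Arguments.
Unset Strict Implicit.
Unset Printing Implicit Defensive.

Import Order.TTheory GRing.Theory Num.Theory.
Import numFieldNormedType.Exports.

Local Open Scope classical_set_scope.
Local Open Scope group_scope.

(* [Group] is the library's class of arbitrary (possibly infinite,
   non-commutative) groups; [Order.POrder] that of partial orders. *)
HB.mixin Record Group_POrder_isInvariant (d : Order.disp_t) G
    of Group G & Order.POrder d G := {
  leg_mul2l : forall g h k : G, (g <= h)%O -> (k * g <= k * h)%O ;
  leg_mul2r : forall g h k : G, (g <= h)%O -> (g * k <= h * k)%O
}.

#[short(type="invPOGroupType")]
HB.structure Definition InvPOGroup (d : Order.disp_t) :=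
  { G of Group G & Order.POrder d G & Group_POrder_isInvariant d G }.

Definition expgz (G : groupType) (g : G) (z : int) : G :=
  match z with
  | Posz n => g ^+ n
  | Negz n => g ^- n.+1
  end.

Section Quasimorphism.
Local Open Scope ring_scope.
Variables (R : realType) (G : groupType).

Definition homogeneous_quasimorphism (f : G -> R) : Prop :=
  (forall (g : G) (n : int), f (expgz g n) = n%:~R * f g) /\
  (exists D : R, forall g h : G, `|f (g * h)%g - f g - f h| <= D).

Definition superlevel (f : G -> R) (C : R) : set G := [set g | C <= f g].

End Quasimorphism.

Section InvariantOrder.
Variables (d : Order.disp_t) (G : invPOGroupType d).

Definition order_semigroup : set G := [set g | (1 <= g)%O].

Definition dominants : set G :=
  [set g | (order_semigroup `\ 1) g /\
           forall h : G, exists n : nat, (h <= g ^+ n)%O].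

Definition admissible : Prop := dominants !=set0.

Definition growth_set (g h : G) (n : nat) : set int :=
  [set p | (h ^+ n <= expgz g p)%O].

Definition minimum (A : set int) : set int := [set m | A m /\ lbound A m].

(* The default value 0 is only taken when there is no minimum. *)
Definition growth_min (g h : G) (n : nat) : int :=
  xget 0%R (minimum (growth_set g h n)).

Variable R : realType.

(* The term at n = 0 is 0 because 0^-1 = 0; it does not affect the limit. *)
Definition growth_seq (g h : G) : nat -> R :=
  fun n => ((n%:R)^-1 * (growth_min g h n)%:~R)%R.

(* The minima and the limit entering [relative_growth] exist, so that no default
   value of [xget] or [lim] is involved in it. *)
Definition relative_growth_defined (g h : G) : Prop :=
  (forall n : nat, minimum (growth_set g h n) !=set0) /\
  cvgn (growth_seq g h).

Definition relative_growth (g h : G) : R := limn (growth_seq g h).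

Definition sandwiches (f : G -> R) : Prop :=
  exists C1 C2 : R, superlevel f C1 `<=` order_semigroup /\
                    order_semigroup `<=` superlevel f C2.

End InvariantOrder.

Arguments order_semigroup {d} G.
Arguments dominants {d} G.
Arguments admissible {d} G.
Arguments relative_growth {d G} R g h.
Arguments relative_growth_defined {d G} R g h.

(* Main.v *)
Require Import Defs.
From mathcomp Require Import all_boot all_order all_algebra.
From mathcomp Require Import all_classical all_reals all_analysis.
From mathcomp Require Import ring lra.
Import Order.TTheory GRing.Theory Num.Theory.
Import numFieldNormedType.Exports.
Local Open Scope ring_scope.

Set Implicit Arguments.
Unset Strict Implicit.

(** Sandwiching makes [f] see the order up to a bounded error.  The order
    semigroup is closed under powers, so homogeneity improves the lower bound
    [C2] of [f] on it to [0] ([sandwich_ge0]).  Writing [a <= b] as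
    [1 <= b * a^-1] and paying the defect [D] to split [f (b * a^-1)], one gets
    [f a - D <= f b] whenever [a <= b] ([sandwich_le]), and [a <= b] whenever
    [f a + D + C1 <= f b] ([le_sandwich]).

    Admissibility follows because a large power of an element of positive value
    dominates ([sandwich_admissible]); conversely every dominant has positive
    value, since its powers exceed elements of arbitrarily large value
    ([dominants_gt0]).  For a dominant [g] the condition [h ^ n <= g ^ p] then
    amounts, up to a bounded error, to [n * f h <= p * f g], so that the least
    such [p] exists and satisfies [p * f g = n * f h + O(1)]
    ([growth_min_near]).  Dividing by [n * f g] gives the limit
    ([growth_seq_cvg]). *)

(** * Minima of sets of integers *)

Lemma minimum_nonempty (A : set int) (b : int) :
  lbound A b -> (A !=set0)%classic -> (minimum A !=set0)%classic.
Proof.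
move=> bA [a Aa].
(* Translating by the lower bound reduces to a set of natural numbers. *)
have exP : exists k : nat, `[< A (b + k%:Z) >].
  exists `|a - b|%N; apply/asboolP.
  by rewrite gez0_abs ?subr_ge0 ?bA// subrKC.
case: (ex_minnP exP) => m /asboolP Am mmin.
exists (b + m%:Z); split=> // x Ax.
have bx : 0 <= x - b by rewrite subr_ge0 bA.
rewrite -lerBrDl -(gez0_abs bx) lez_nat mmin//; apply/asboolP.
by rewrite gez0_abs// subrKC.
Qed.

(** * A limit criterion *)

(** Integer multiples of two reals that stay within bounded distance have
    coefficients growing at the rate given by the quotient: the error divided by
    [n * y] tends to [0]. *)
Lemma cvg_ratio_bounded_dist (R : realType) (m : nat -> int) (x y K : R) :
  0 < y -> (forall n, `|(m n)%:~R * y - n%:R * x| <= K) ->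
  ((fun n => n%:R^-1 * (m n)%:~R) @ \oo --> x / y)%classic.
Proof.
move=> y0 mK; rewrite -(cvg_shiftS (fun n => n%:R^-1 * (m n)%:~R : R)).
(* The bounds [s = -1] and [s = 1] squeeze the sequence; the shift has put
   its index in the form that [harmonic] uses. *)
have hK (s : R) :
    ((fun n => x / y + s * (K / y) * harmonic n) @ \oo --> x / y)%classic.
  rewrite -[X in (_ --> X)%classic]addr0 -(mulr0 (s * (K / y))).
  by apply: cvgD; [exact: cvg_cst|apply: cvgMl_tmp; exact: cvg_harmonic].
apply: (@squeeze_cvgr _ _ _ _ _ _ _ _ _ (hK (-1)) (hK 1)).
near=> n.
rewrite mulN1r mul1r mulNr -ler_distl /harmonic /=.
have n0 : 0 < n.+1%:R :> R by rewrite ltr0n.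
have -> : n.+1%:R^-1 * (m n.+1)%:~R - x / y =
    ((m n.+1)%:~R * y - n.+1%:R * x) / (y * n.+1%:R).
  by field; rewrite ?lt0r_neq0.
rewrite -[leRHS]mulrA -invfM normrM (ger0_norm (x := (y * _)^-1)).
  by rewrite ler_wpM2r ?mK ?invr_ge0 ?mulr_ge0 ?ltW.
by rewrite invr_ge0 mulr_ge0 ?ltW.
Unshelve. all: by end_near. Qed.

(** * Homogeneous quasimorphisms *)

Section HomogeneousQuasimorphism.
Variables (R : realType) (G : groupType) (f : G -> R).
Hypothesis fZ : forall (g : G) (n : int), f (expgz g n) = n%:~R * f g.

Lemma hqm_expg g (n : nat) : f (g ^+ n)%g = n%:R * f g.
Proof. exact: (fZ g n%:Z). Qed.

Lemma hqm_one : f 1%g = 0.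
Proof. by have := hqm_expg 1%g 0; rewrite mul0r. Qed.

Lemma hqm_inv g : f (g^-1)%g = - f g.
Proof. by have := fZ g (Negz 0); rewrite /= mulN1r. Qed.

Lemma hqm_exists_gt0 : (exists g, f g != 0) -> exists g, 0 < f g.
Proof.
move=> [g]; case: (ltrgtP (f g) 0) => // fg _; last by exists g.
by exists (g^-1)%g; rewrite hqm_inv oppr_gt0.
Qed.

Lemma hqm_expg_large g (C : R) :
  0 < f g -> exists n : nat, C <= f (g ^+ n)%g.
Proof.
move=> fg; exists (Num.bound `|C / f g|).
by rewrite hqm_expg -ler_pdivrMr// (le_trans (ler_norm _))//;
  apply/ltW/archi_boundP.
Qed.

End HomogeneousQuasimorphism.

(** * Sandwiched orders *)

Section Sandwich.
Variables (R : realType) (d : Order.disp_t) (G : invPOGroupType d).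
Variables (f : G -> R) (D C1 C2 : R).
Hypothesis fZ : forall (g : G) (n : int), f (expgz g n) = n%:~R * f g.
Hypothesis fD : forall g h : G, `|f (g * h)%g - f g - f h| <= D.
Hypothesis C1P : forall g : G, C1 <= f g -> (1%g <= g)%O.
Hypothesis C2P : forall g : G, (1%g <= g)%O -> C2 <= f g.

Lemma expg_ge1 (g : G) n : (1%g <= g)%O -> (1%g <= (g ^+ n)%g)%O.
Proof.
move=> g1; elim: n => [|n IH]; first by rewrite expg0.
rewrite expgS; apply: (le_trans g1).
by have := leg_mul2l _ _ g IH; rewrite mulg1.
Qed.

Lemma leg_divr (a b : G) : (a <= b)%O <-> (1%g <= (b * a^-1)%g)%O.
Proof.
split=> ab.
  by have := leg_mul2r _ _ a^-1%g ab; rewrite mulgV.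
by have := leg_mul2r _ _ a ab; rewrite mul1g mulgVK.
Qed.

(** A negative value would drop below [C2] along the powers. *)
Lemma sandwich_ge0 g : (1%g <= g)%O -> 0 <= f g.
Proof.
move=> g1; rewrite leNgt; apply/negP => fg.
have fV : 0 < f (g^-1)%g by rewrite hqm_inv// oppr_gt0.
have [n] := hqm_expg_large fZ (1 - C2) fV.
rewrite expVgn hqm_inv// => hn.
by have := C2P (expg_ge1 n g1); lra.
Qed.

Lemma hqm_divr_dist (a b : G) : `|f (b * a^-1)%g - f b + f a| <= D.
Proof. by have := fD b a^-1%g; rewrite hqm_inv// opprK. Qed.

Lemma sandwich_le (a b : G) : (a <= b)%O -> f a - D <= f b.
Proof.
move=> /leg_divr /sandwich_ge0.
by have := hqm_divr_dist a b; rewrite ler_norml => /andP[]; lra.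
Qed.

Lemma le_sandwich (a b : G) : f a + D + C1 <= f b -> (a <= b)%O.
Proof.
move=> ab; apply/leg_divr/C1P.
by have := hqm_divr_dist a b; rewrite ler_norml => /andP[]; lra.
Qed.

Lemma sandwich_admissible : (exists g, f g != 0) -> admissible G.
Proof.
move=> /(hqm_exists_gt0 fZ)[g g0].
(* Positivity of the power is demanded along with [C1], to keep it away from
   the unit. *)
have [k] := hqm_expg_large fZ (Num.max C1 1) g0.
set x := (g ^+ k)%g; rewrite ge_max => /andP[xC1 x1].
have x0 : 0 < f x := lt_le_trans ltr01 x1.
exists x; split.
  split; first exact: C1P.
  by move=> /= x_eq1; move: x0; rewrite x_eq1 hqm_one// ltxx.
move=> h; have [n hn] := hqm_expg_large fZ (f h + D + C1) x0.
by exists n; apply: le_sandwich.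
Qed.

Lemma dominants_gt0 g : (exists x, f x != 0) -> dominants G g -> 0 < f g.
Proof.
move=> /(hqm_exists_gt0 fZ)[x x0] [_ gdom].
have [k hk] := hqm_expg_large fZ (D + 1) x0.
have [n /sandwich_le] := gdom (x ^+ k)%g.
rewrite (hqm_expg fZ g) => hn.
have : 0 < n%:R * f g by lra.
by rewrite ltNge => /negP nfg; rewrite ltNge; apply/negP => fg;
  apply: nfg; rewrite mulr_ge0_le0.
Qed.

Section Growth.
Variables (g h : G).
Hypothesis fg0 : 0 < f g.

Lemma growth_set_ge n p :
  growth_set g h n p -> n%:R * f h - D <= p%:~R * f g.
Proof. by move=> /sandwich_le; rewrite fZ hqm_expg. Qed.

Lemma growth_setP n p :
  n%:R * f h + D + C1 <= p%:~R * f g -> growth_set g h n p.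
Proof. by move=> np; apply: le_sandwich; rewrite fZ hqm_expg. Qed.

Lemma growth_minimum_nonempty n :
  (minimum (growth_set g h n) !=set0)%classic.
Proof.
apply: (@minimum_nonempty _ (Num.floor ((n%:R * f h - D) / f g))).
  move=> p /growth_set_ge; rewrite -ler_pdivrMr// => np.
  by rewrite -(ler_int R); apply: le_trans np; rewrite floor_le.
exists (Num.ceil ((n%:R * f h + D + C1) / f g)).
by apply: growth_setP; rewrite -ler_pdivrMr// ceil_ge.
Qed.

(** The predecessor of the minimum fails [growth_setP], which bounds the minimum
    from above at the cost of one extra [f g]. *)
Lemma growth_min_near n :
  `|(growth_min g h n)%:~R * f g - n%:R * f h| <= D + `|C1| + f g.
Proof.
have [x xmin] := growth_minimum_nonempty n.
have [+ minP] : minimum (growth_set g h n) (growth_min g h n) :=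
  xgetI 0 xmin.
set m := growth_min g h n in minP *.
move=> /growth_set_ge lo.
have hi : (m - 1)%:~R * f g < n%:R * f h + D + C1.
  rewrite ltNge; apply/negP => /growth_setP/minP.
  by rewrite lerDl.
rewrite intrB mulrBl mul1r in hi.
have C1_ge0 : 0 <= `|C1| := normr_ge0 _.
have C1_le : C1 <= `|C1| := ler_norm _.
by rewrite ler_norml; have fg_gt0 := fg0; apply/andP; split; lra.
Qed.

Lemma growth_seq_cvg : (growth_seq R g h @ \oo --> f h / f g)%classic.
Proof. exact: cvg_ratio_bounded_dist fg0 growth_min_near. Qed.

End Growth.
End Sandwich.

(** * Relative growth of a sandwiched order *)

Unset Implicit Arguments.
Set Strict Implicit.

Theorem proposition3p3 (R : realType) (d : Order.disp_t)
    (G : invPOGroupType d) (f : G -> R)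
    (hf : homogeneous_quasimorphism f) (hf0 : exists g : G, f g != 0)
    (hs : sandwiches f) :
  admissible G /\
  (forall g h : G, dominants G g ->
     relative_growth_defined R g h /\
     relative_growth R g h = f h / f g).
Proof.
have [fZ [D fD]] := hf; have [C1 [C2 [C1P C2P]]] := hs.
split; first exact: sandwich_admissible fZ fD C1P hf0.
move=> g h gdom.
have fg0 := dominants_gt0 fZ fD C2P hf0 gdom.
have gcvg := growth_seq_cvg fZ fD C1P C2P fg0 (h := h).
split; last exact: cvg_lim gcvg.
split; last by apply/cvg_ex; exists (f h / f g).
move=> n; exact: (growth_minimum_nonempty fZ fD C1P C2P h fg0 n).
Qed.
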